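(* Let $m\ge2$ be an integer, let $p$ be a prime, let $f\in\mathbb{F}_p[X]$ be a polynomial of degree $m$, let $R,S$ be integers and let $M$ be an integer with $1\le M<p$. Let $J_f(M;R,S)$ denote the number of integer pairs $(x,y)\in[R+1,R+M]\times[S+1,S+M]$ with $f(x)\equiv y\pmod p$. Then $$J_f(M;R,S)\ll\frac{M^2}{p}+M^{1-1/2^{m-1}}p^{o(1)}$$ as $p\to\infty$.
   Context: Elements of $\mathbb{F}_p$ are identified with $\{0,1,\dots,p-1\}$. The implied constant in $\ll$ depends only on $m$, and $p^{o(1)}$ denotes $p^{\varepsilon(p)}$ with $\varepsilon(p)\to0$ as $p\to\infty$, uniformly in $f,R,S,M$. *)

(* Defs.v *)
From HB Require Import structures.
From mathcomp Require Import all_boot all_order all_algebra.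
From mathcomp Require Import finmap.
From mathcomp Require Import zify.
From mathcomp Require Import all_classical all_reals all_analysis.

Set Implicit Arguments.
Unset Strict Implicit.
Unset Printing Implicit Defensive.

Import Order.TTheory GRing.Theory Num.Theory.

Local Open Scope classical_set_scope.
Local Open Scope ring_scope.

(* For x : int, x%:~R is the residue class of x in 'F_p, so the last clause is
   the congruence f(x) = y mod p. *)
Definition box_points (p : nat) (f : {poly 'F_p}) (M : nat) (R S : int) :
    set (int * int) :=
  [set xy | [/\ R + 1 <= xy.1 <= R + M%:Z,
                S + 1 <= xy.2 <= S + M%:Z &
                f.[xy.1%:~R] = xy.2%:~R]].

(* fset_set is junk (empty) on infinite sets; this rules that case out. *)
Lemma finite_box_points (p : nat) (f : {poly 'F_p}) (M : nat) (R S : int) :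
  finite_set (box_points f M R S).
Proof.
have finI (T : int) : finite_set [set x : int | T + 1 <= x <= T + M%:Z].
  apply: (@sub_finite_set _ _ [set T + k%:Z | k in `I_M.+1]).
    move=> x /= /andP[Tx xT]; exists `|x - T|%N.
      by rewrite -ltz_nat gez0_abs; lia.
    by rewrite gez0_abs; lia.
  exact/finite_image/finite_II.
apply: (sub_finite_set _ (finite_setX (finI R) (finI S))).
by move=> [x y] [].
Qed.

Definition J (p : nat) (f : {poly 'F_p}) (M : nat) (R S : int) : nat :=
  #|` fset_set (box_points f M R S)|.

(* Main.v *)
(** Let D = 2^(m-1).  Up to a shift, J counts the x in a box of length M for
    which f(x) lies in a box of length M.  With L comparable to p/M, the Fejer
    kernel |sum_(a<L) e(a y)|^2 is at least L^2/4 on the box, so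
    J <= (4/L) sum_(|a|<L) |S(a)| with S(a) = sum_x w(x) e(a f(x)), where w is a
    Fejer weight dominating the box of the variable x.  The frequency a = 0
    yields M^2/p.

    For the others, Weyl differencing m-1 times bounds |S(a)|^D by
    M^(D-m) times the sum over h_1, ..., h_(m-1) of the Fourier coefficient of a
    product of D translates of w at m! lc(f) a h_1 ... h_(m-1).  Since the Fourier
    transform of w is nonnegative, that coefficient is dominated, uniformly in
    the h_i, by the coefficient of w^D, whose total mass over F_p is p 2^D.  The
    terms with a h_1 ... h_(m-1) <> 0 are grouped according to this integer,
    which by the divisor bound has p^o(1) representations. *)
Require Import Defs.
From HB Require Import structures.
From mathcomp Require Import all_boot all_order all_algebra.
From mathcomp Require Import finmap zify ring lra.
From mathcomp Require Import all_classical all_reals all_analysis.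
From mathcomp.real_closed Require Import complex.
Set Implicit Arguments.
Unset Strict Implicit.
Unset Printing Implicit Defensive.
Import Order.TTheory GRing.Theory Num.Theory.
Import numFieldNormedType.Exports.

(** * The divisor bound *)

(** For positive [k] one has [e.+1 <= k * 2 ^ (e %/ k)]; the [k]-th power of this gives the claim.
    It absorbs the exponent [e] of a small prime at the cost of [k ^ k]. *)
Lemma leq_expSn_exp2 (k e : nat) : e.+1 ^ k <= k ^ k * 2 ^ e.
Proof.
case: k => [|k]; first by rewrite !expn0 mul1n expn_gt0.
have le_e : e.+1 <= k.+1 * 2 ^ (e %/ k.+1).
  apply: leq_trans (ltn_ceil e (ltn0Sn k)) _.
  by rewrite mulnC leq_mul2l /= ltn_expl.
have := le_e; rewrite -(leq_exp2r _ _ (ltn0Sn k)) => /leq_trans; apply.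
by rewrite expnMn -expnM leq_mul2l leq_exp2l // leq_trunc_div orbT.
Qed.

(** A divisor of [n] is determined by its [p]-adic valuation and its part prime to [p]. *)
Lemma size_divisors_part (p n : nat) : 0 < n ->
  size (divisors n) <= (logn p n).+1 * size (divisors n`_p^').
Proof.
move=> n0.
pose g d := (logn p d, d`_p^').
have gI : {in divisors n &, injective g}.
  move=> d e; rewrite -!dvdn_divisors // => /dvdn_gt0 d0 /dvdn_gt0 e0 [E1 E2].
  rewrite -(partnC p (d0 n0)) -(partnC p (e0 n0)).
  by rewrite !p_part E1 E2.
rewrite -(size_map g) -[X in X * _](size_iota 0) -(size_allpairs pair).
apply: uniq_leq_size; first by rewrite map_inj_in_uniq // divisors_uniq.
move=> _ /mapP[d dn ->]; rewrite -dvdn_divisors // in dn.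
apply/allpairsP; exists (g d); split => //.
  by rewrite mem_iota /= add0n ltnS dvdn_leq_log.
by rewrite /= -dvdn_divisors ?part_gt0 // partn_dvd.
Qed.

(* A prime q >= 2^k satisfies (e+1)^k <= q^e, so only the primes below 2^k cost a constant. *)
Lemma size_divisors_expn_count (k n : nat) : 0 < n ->
  size (divisors n) ^ k
    <= (k ^ k) ^ (count (fun q => q < 2 ^ k) (primes n)) * n.
Proof.
elim/ltn_ind: n => n IH n0.
case: (ltnP 1 n) => [n1|]; last first.
  by case: n n0 {IH} => [|[|]] //= _ _; rewrite exp1n.
set p := pdiv n; have pp : prime p by exact: pdiv_prime.
have pn : p \in primes n by rewrite mem_primes pp n0 pdiv_dvd.
have l0 : 0 < logn p n by rewrite logn_gt0.
have nE : n = p ^ logn p n * n`_p^' by rewrite -p_part partnC.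
set n' := n`_p^' in nE *; set e := logn p n in nE l0 *.
have n'0 : 0 < n' by rewrite part_gt0.
have n'n : n' < n.
  rewrite nE ltn_Pmull // -(exp1n e) ltn_exp2r // prime_gt1 //.
have cE : count (fun q => q < 2 ^ k) (primes n)
    = (p < 2 ^ k) + count (fun q => q < 2 ^ k) (primes n').
  have := perm_to_rem pn; rewrite rem_filter ?primes_uniq // => /permP -> /=.
  by rewrite primes_part; congr (_ + count _ _); apply: eq_filter => q; rewrite !inE.
rewrite cE expnD.
have /leq_trans -> // : size (divisors n) ^ k <= e.+1 ^ k * size (divisors n') ^ k.
  rewrite -expnMn; case: (k) => // j; rewrite leq_exp2r //.
  exact: size_divisors_part.
rewrite [n in leqRHS]nE mulnACA leq_mul // ?IH //.
case: ltnP => [_|hp]; last first.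
  rewrite expn0 mul1n; apply: leq_trans (_ : (2 ^ e) ^ k <= _); last first.
    by rewrite -expnM mulnC expnM leq_exp2r.
  by case: (k) => // j; rewrite leq_exp2r // ltn_expl.
rewrite expn1; apply: leq_trans (leq_expSn_exp2 k e) _.
by rewrite leq_mul2l leq_exp2r // prime_gt1 // orbT.
Qed.

(** As [k] is arbitrary, this is the n^o(1) divisor bound without real exponents. There are at most
    [2 ^ k] primes below [2 ^ k]. *)
Lemma size_divisors_expn (k : nat) :
  {C | forall n, 0 < n -> size (divisors n) ^ k <= C * n}.
Proof.
exists ((k ^ k) ^ (2 ^ k)) => n n0.
apply: leq_trans (size_divisors_expn_count k n0) _.
rewrite leq_mul2r leq_pexp2l ?orbT //; first by case: (k) => // j; rewrite expn_gt0.
rewrite -size_filter -[X in _ <= X](size_iota 0); apply: uniq_leq_size.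
  by rewrite filter_uniq ?primes_uniq.
by move=> q; rewrite mem_filter mem_iota /= add0n => /andP[].
Qed.

Local Open Scope ring_scope.

(** * Fourier analysis and Weyl differencing over a finite field *)

Section PowerMean.
Variable C : numClosedFieldType.

Lemma sqr_sum_le (I : Type) (s : seq I) (x : I -> C) :
  (forall i, 0 <= x i) ->
  (\sum_(i <- s) x i) ^+ 2 <= (size s)%:R * \sum_(i <- s) x i ^+ 2.
Proof.
move=> x0; elim: s => [|a s IH]; first by rewrite !big_nil mul0r expr0n.
rewrite !big_cons /= -natr1 sqrrD.
set S := \sum_(i <- s) x i in IH *; set Q := \sum_(i <- s) x i ^+ 2 in IH *.
have S0 : 0 <= S by rewrite sumr_ge0.
have hx : x a * S *+ 2 <= (size s)%:R * x a ^+ 2 + Q.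
  rewrite /S /Q; elim: (s) => [|b t IHt]; first by rewrite !big_nil mulr0 mul0rn mul0r addr0.
  rewrite !big_cons /= -natr1 mulrDr mulrnDl mulrDl mul1r.
  rewrite [X in _ <= X](_ : _ = (x a ^+ 2 + x b ^+ 2) +
    ((size t)%:R * x a ^+ 2 + \sum_(i <- t) x i ^+ 2)); last by ring.
  apply: lerD => //; rewrite -subr_ge0 addrAC -sqrrB -realEsqr realB //; exact: ger0_real.
rewrite [X in _ <= X](_ : _ =
  x a ^+ 2 + ((size s)%:R * x a ^+ 2 + Q) + (size s)%:R * Q); last by ring.
by apply: lerD => //; apply: lerD.
Qed.

(** Cauchy-Schwarz iterated [k] times. *)
Lemma power_mean (I : Type) (s : seq I) (x : I -> C) (k : nat) :
  (forall i, 0 <= x i) ->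
  (\sum_(i <- s) x i) ^+ (2 ^ k)
    <= (size s)%:R ^+ (2 ^ k - 1) * \sum_(i <- s) x i ^+ (2 ^ k).
Proof.
elim: k x => [|k IH] x x0; first by rewrite expn0 subnn expr0 mul1r expr1.
rewrite expnS exprM.
apply: le_trans (_ : ((size s)%:R * \sum_(i <- s) x i ^+ 2) ^+ (2 ^ k) <= _).
  rewrite lerXn2r ?nnegrE ?exprn_ge0 ?mulr_ge0 ?sumr_ge0 ?ler0n ?sqr_sum_le // => i _.
  by rewrite exprn_ge0.
rewrite exprMn.
apply: le_trans (ler_wpM2l _ (IH (fun i => x i ^+ 2) _)) _ => [|i|].
- by rewrite exprn_ge0 ?ler0n.
- by rewrite exprn_ge0.
rewrite mulrA -exprD; under eq_bigr do rewrite -exprM.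
by rewrite [(2 ^ k + _)%N](_ : _ = (2 * 2 ^ k - 1)%N) //; have := expn_gt0 2 k; lia.
Qed.

(** Distinct integer shifts may have the same residue; this discards the repetitions. *)
Lemma ler_sum_undup (T : eqType) (s : seq T) (x : T -> C) :
  (forall i, 0 <= x i) -> \sum_(i <- undup s) x i <= \sum_(i <- s) x i.
Proof.
move=> x0; elim: s => [|a s IH] /=; first by rewrite !big_nil.
rewrite big_cons; case: ifP => _; last by rewrite big_cons lerD2l.
by apply: le_trans IH _; rewrite lerDr.
Qed.

End PowerMean.

Section Fourier.
Variables (F : finFieldType) (C : numClosedFieldType) (e : F -> C).
Hypothesis eD : forall x y, e (x + y) = e x * e y.
Hypothesis e_norm : forall x, `|e x| = 1.
Hypothesis e_nontriv : exists x, e x != 1.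

Lemma addchar0 : e 0 = 1.
Proof.
have e0 : e 0 != 0 by rewrite -normr_eq0 e_norm oner_eq0.
by apply: (mulfI e0); rewrite -eD addr0 mulr1.
Qed.

Lemma addcharN x : e (- x) = (e x)^*.
Proof.
have ex : e x != 0 by rewrite -normr_eq0 e_norm oner_eq0.
by apply: (mulfI ex); rewrite -eD subrr addchar0 -normCK e_norm expr1n.
Qed.

Lemma addchar_sum (t : F) : \sum_x e (t * x) = if t == 0 then #|F|%:R else 0.
Proof.
case: eqP => [->|/eqP t0].
  by under eq_bigr do rewrite mul0r addchar0; rewrite sumr_const -mulr_natl mulr1.
case: e_nontriv => y ey.
have : (1 - e y) * \sum_x e (t * x) = 0.
  rewrite mulrBl mul1r mulr_sumr (reindex_inj (addIr (t^-1 * y))) /=.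
  rewrite -sumrB big1 // => x _; rewrite mulrDr mulVKf // eD; ring.
by move/eqP; rewrite mulf_eq0 subr_eq0 eq_sym (negPf ey) => /eqP.
Qed.

Definition fourier (g : F -> C) (t : F) : C := \sum_x g x * e (t * x).

(** The transform is not normalised, hence the factor [#|F|]: summing over [u] leaves only the
    diagonal of the double sum, by orthogonality. *)
Lemma fourierM_conv (g1 g2 : F -> C) (t : F) :
  #|F|%:R * fourier (fun x => g1 x * g2 x) t =
  \sum_u fourier g1 u * fourier g2 (t - u).
Proof.
have E u : fourier g1 u * fourier g2 (t - u) =
    \sum_x \sum_y g1 x * g2 y * e (t * y) * e ((x - y) * u).
  rewrite mulr_suml; apply: eq_bigr => x _; rewrite mulr_sumr; apply: eq_bigr => y _.
  rewrite mulrACA -mulrA -!mulrA; congr (_ * (_ * _)); rewrite -!eD; congr e; ring.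
rewrite (eq_bigr _ (fun u _ => E u)) exchange_big /= mulr_sumr; apply: eq_bigr => x _.
rewrite exchange_big /= (bigD1 x) //= [X in _ = _ + X]big1 => [|y yx].
  rewrite addr0 -mulr_sumr subrr addchar_sum eqxx; ring.
by rewrite -mulr_sumr addchar_sum subr_eq0 eq_sym (negPf yx) mulr0.
Qed.

Lemma fourier_shift (g : F -> C) (h t : F) :
  fourier (fun x => g (x + h)) t = e (- (t * h)) * fourier g t.
Proof.
rewrite /fourier mulr_sumr [RHS](reindex_inj (addIr h)) /=.
apply: eq_bigr => x _; rewrite mulrCA -eD; congr (_ * e _); ring.
Qed.

Lemma fourier_conj (g : F -> C) (t : F) :
  fourier (fun x => (g x)^*) t = (fourier g (- t))^*.
Proof.
rewrite /fourier rmorph_sum; apply: eq_bigr => x _.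
by rewrite rmorphM /= -addcharN mulNr opprK.
Qed.

(** Fourier inversion at 0. *)
Lemma fourier_sum (g : F -> C) : \sum_t fourier g t = #|F|%:R * g 0.
Proof.
rewrite exchange_big /= (bigD1 0) //= [X in _ + X]big1 => [|x x0].
  under eq_bigr do rewrite mulr0 addchar0 mulr1.
  by rewrite sumr_const addr0 [RHS]mulr_natl.
rewrite -mulr_sumr; under eq_bigr do rewrite mulrC.
by rewrite addchar_sum (negPf x0) mulr0.
Qed.

Lemma natr_card_gt0 : 0 < #|F|%:R :> C.
Proof. by rewrite ltr0n; apply/card_gt0P; exists 0. Qed.

(* This domination is stable under differencing, uniformly in the shift: a translation
   changes the Fourier coefficients of g by phases only. *)
Definition majorized (g phi : F -> C) := forall t, `|fourier g t| <= fourier phi t.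

(** By the convolution formula the coefficient is an average of products of two coefficients of [g],
    up to phases and conjugation. Conjugation reflects the frequency; this is harmless because [phi]
    and its transform are real, so that the transform is even. *)
Lemma majorized_diff (g phi : F -> C) (h : F) :
  (forall x, (phi x)^* = phi x) -> majorized g phi ->
  majorized (fun x => g (x + h) * (g x)^*) (fun x => phi x ^+ 2).
Proof.
move=> phiR gphi t.
have phi_real u : (fourier phi u)^* = fourier phi u.
  by apply: geC0_conj; apply: le_trans (gphi u).
rewrite -(ler_pM2l natr_card_gt0) -[X in X * `|_|]ger0_norm ?ler0n // -normrM.
rewrite (fourierM_conv (fun x => g (x + h))).
rewrite [X in _ <= _ * X](_ : _ = fourier (fun x => phi x * phi x) t); last first.
  by apply: eq_bigr => x _; rewrite expr2.
rewrite fourierM_conv; apply: le_trans (ler_norm_sum _ _ _) _.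
apply: ler_sum => u _; rewrite normrM fourier_shift normrM e_norm mul1r.
apply: ler_pM => //; rewrite fourier_conj norm_conjC.
apply: le_trans (gphi _) _; rewrite -phi_real -fourier_conj.
by rewrite /fourier; under eq_bigr do rewrite phiR.
Qed.


(** Unfolded, this is the sum of [Phi (t * h_1 * ... * h_k)] over all [k]-tuples from [hs]; the
    recursion follows the differencing steps. *)
Fixpoint dilate_sum (hs : seq int) (Phi : F -> C) (k : nat) (t : F) : C :=
  if k is k'.+1 then \sum_(h <- hs) dilate_sum hs Phi k' (t * h%:~R) else Phi t.

Lemma eq_dilate_sum (hs : seq int) (Phi Psi : F -> C) (k : nat) :
  Phi =1 Psi -> dilate_sum hs Phi k =1 dilate_sum hs Psi k.
Proof.
by move=> E; elim: k => [|k IH] t //=; apply: eq_bigr => h _.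
Qed.

(** The squared modulus is a double sum, grouped by the difference of its two variables; only
    differences represented in [hs] contribute. *)
Lemma van_der_corput (hs : seq int) (G : F -> C) :
  (forall x y, G x != 0 -> G y != 0 -> x - y \in [seq h%:~R | h <- hs]) ->
  `|\sum_x G x| ^+ 2 <= \sum_(h <- hs) `|\sum_x G (x + h%:~R) * (G x)^*|.
Proof.
move=> suppG; rewrite -[leLHS]ger0_norm ?exprn_ge0 // normCK rmorph_sum mulr_suml /=.
under eq_bigr do rewrite mulr_sumr.
rewrite exchange_big /=.
under eq_bigr => y _ do rewrite (reindex_inj (addIr y)) /=.
rewrite exchange_big /=; set A := fun h => \sum_x G (h + x) * (G x)^*.
have A0 h : h \notin [seq h%:~R | h <- hs] -> A h = 0.
  move=> hN; apply: big1 => x _; case: (G (h + x) =P 0) => [->|/eqP Gh]; first by rewrite mul0r.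
  case: (G x =P 0) => [->|/eqP Gx]; first by rewrite conjC0 mulr0.
  by have := suppG _ _ Gh Gx; rewrite addrK (negPf hN).
apply: le_trans (_ : \sum_(h <- [seq h%:~R | h <- hs]) `|A h| <= _).
  apply: le_trans (ler_sum_undup _ _) => [|h]; last exact: normr_ge0.
  rewrite (big_uniq _ (undup_uniq _)) /= -/A.
  rewrite (bigID (mem (undup [seq h%:~R | h <- hs]))) /= [X in _ + X]big1 ?addr0.
    exact: ler_norm_sum.
  by move=> h; rewrite mem_undup => /A0.
by rewrite big_map; apply: ler_sum => h _; rewrite /A; under eq_bigr do rewrite addrC.
Qed.

(** The difference p(X + h) - p(X), expanded in Hasse derivatives so that the drop in degree is
    visible in every characteristic. *)
Definition diff_poly (R : comNzRingType) (p : {poly R}) (h : R) : {poly R} :=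
  \sum_(1 <= i < size p) h ^+ i *: p^`N(i).

Lemma hornerE_diff_poly (R : comNzRingType) (p : {poly R}) (h x : R) :
  (diff_poly p h).[x] = p.[x + h] - p.[x].
Proof.
have [->|p0] := eqVneq p 0.
  by rewrite /diff_poly size_poly0 big_geq // !horner0 subr0.
rewrite (@nderiv_taylor _ p x h) //; last exact: mulrC.
rewrite -(big_mkord xpredT (fun i => p^`N(i).[x] * h ^+ i)).
rewrite big_ltn ?lt0n ?size_poly_eq0 // expr0 mulr1 nderivn0 addrAC subrr add0r.
by rewrite horner_sum; apply: eq_bigr => i _; rewrite hornerZ mulrC.
Qed.

Lemma coef_diff_poly (R : comNzRingType) (p : {poly R}) (h : R) (k : nat) :
  (size p <= k.+2)%N ->
  (diff_poly p h)`_k = h * (p`_k.+1 *+ k.+1).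
Proof.
move=> sp; rewrite /diff_poly coef_sum.
have [s1|s1] := leqP (size p) 1.
  by rewrite big_geq // nth_default ?mul0rn ?mulr0 // (leq_trans s1).
rewrite big_ltn // coefZ expr1 coef_nderivn bin1 add1n big1_seq ?addr0 // => i.
rewrite mem_index_iota => /andP[_ /andP[i2 _]].
by rewrite coefZ coef_nderivn nth_default ?mul0rn ?mulr0 // (leq_trans sp) // -add2n leq_add2r.
Qed.

Lemma size_diff_poly (R : comNzRingType) (p : {poly R}) (h : R) (k : nat) :
  (size p <= k.+1)%N -> (size (diff_poly p h) <= k)%N.
Proof.
move=> sp; apply/leq_sizeP => j kj; rewrite /diff_poly coef_sum big1_seq // => i.
rewrite mem_index_iota => /andP[_ /andP[i1 _]].
by rewrite coefZ coef_nderivn nth_default ?mul0rn ?mulr0 // (leq_trans sp) // -add1n leq_add.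
Qed.

(** Each induction step replaces [g] by a difference polynomial, [u] by a product of two of its
    translates (one conjugated) and [phi] by its square. The factorial collects the factors that
    differencing puts on the leading coefficient. *)
Lemma weyl_differencing (hs : seq int) (k : nat) (g : {poly F}) (u phi : F -> C) :
  (size g <= k.+2)%N ->
  (forall x y, u x != 0 -> u y != 0 -> x - y \in [seq h%:~R | h <- hs]) ->
  (forall x, (phi x)^* = phi x) -> majorized u phi ->
  `|\sum_x u x * e g.[x]| ^+ (2 ^ k) <=
    (size hs)%:R ^+ (2 ^ k - k.+1) *
    dilate_sum hs (fourier (fun x => phi x ^+ (2 ^ k))) k ((k.+1)`!%:R * g`_k.+1).
Proof.
elim: k g u phi => [|k IH] g u phi sg suppu phiR uphi.
  (* For linear [g] the sum is a phase times a Fourier coefficient of [u]. *)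
  rewrite /= subnn expr0 mul1r expr1 (_ : 1`! = 1%N) ?mul1r //.
  have E : \sum_x u x * e g.[x] = e g`_0 * fourier u g`_1.
    rewrite /fourier mulr_sumr; apply: eq_bigr => x _.
    by rewrite mulrCA -eD (horner_coef_wide _ sg) big_ord_recl big_ord1 expr0 mulr1 expr1.
  rewrite E normrM e_norm mul1r; apply: le_trans (uphi _) _.
  by rewrite /fourier; under [leRHS]eq_bigr do rewrite expr1.
rewrite expnS exprM.
have e_neq0 x : e x != 0 by rewrite -normr_eq0 e_norm oner_eq0.
pose D h := \sum_x (u (x + h%:~R) * (u x)^*) * e (diff_poly g h%:~R).[x].
have vdc : `|\sum_x u x * e g.[x]| ^+ 2 <= \sum_(h <- hs) `|D h|.
  apply: le_trans (@van_der_corput hs _ _) _.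
    by move=> x y; rewrite !mulf_eq0 !(negPf (e_neq0 _)) !orbF; exact: suppu.
  apply: ler_sum => h _; rewrite /D le_eqVlt; apply/orP; left; apply/eqP; congr `|_|.
  apply: eq_bigr => x _.
  by rewrite rmorphM /= -addcharN mulrACA -eD hornerE_diff_poly.
apply: le_trans (_ : (\sum_(h <- hs) `|D h|) ^+ (2 ^ k) <= _).
  by rewrite lerXn2r ?nnegrE ?exprn_ge0 ?sumr_ge0.
apply: le_trans (power_mean _ _ _) _ => [h|]; first exact: normr_ge0.
(* The power mean inequality supplies [2 ^ k - 1] factors [size hs], the induction hypothesis the
   others; no subtraction is truncated, since [k < 2 ^ k]. *)
have -> : (2 * 2 ^ k - k.+2 = (2 ^ k - 1) + (2 ^ k - k.+1))%N.
  by have := ltn_expl k (isT : 1 < 2)%N; lia.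
rewrite exprD -mulrA ler_wpM2l ?exprn_ge0 ?ler0n //= mulr_sumr.
apply: ler_sum => h _.
have := IH (diff_poly g h%:~R) (fun x => u (x + h%:~R) * (u x)^* ) (fun x => phi x ^+ 2) _ _ _ _.
rewrite coef_diff_poly // => /(_ (size_diff_poly _ sg)) => IH'.
apply: le_trans (IH' _ _ _) _.
- move=> x y; rewrite !mulf_eq0 !negb_or !conjC_eq0 => /andP[_ ux] /andP[_ uy].
  exact: suppu.
- by move=> x; rewrite rmorphXn /= phiR.
- exact: majorized_diff.
rewrite ler_wpM2l ?exprn_ge0 ?ler0n // le_eqVlt; apply/orP; left; apply/eqP.
have -> : k.+1`!%:R * (h%:~R * (g`_k.+2 *+ k.+2)) = k.+2`!%:R * g`_k.+2 * h%:~R.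
  rewrite (factS k.+1) natrM -[g`_k.+2 *+ _]mulr_natl; ring.
apply: eq_dilate_sum => t; apply: eq_bigr => x _.
by rewrite -exprM -expnS.
Qed.

End Fourier.

(** * Grouping the dilates by the divisor bound *)

Definition int_ball (N : nat) : seq int := [seq i%:Z - N%:Z | i <- iota 0 (2 * N).+1].

Lemma mem_int_ball (N : nat) (n : int) : (n \in int_ball N) = (`|n|%N <= N)%N.
Proof.
apply/mapP/idP => [[j]|nN]; first by rewrite mem_iota => ?; lia.
exists `|(n + N%:Z)%R|%N; last by lia.
by rewrite mem_iota; lia.
Qed.

Lemma int_ball_uniq (N : nat) : uniq (int_ball N).
Proof. by rewrite map_inj_uniq ?iota_uniq // => i j; lia. Qed.

Lemma size_int_ball (N : nat) : size (int_ball N) = (2 * N).+1.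
Proof. by rewrite size_map size_iota. Qed.

(** Induction on [t]: its head occurs at most [mu] times in [s], and all these copies are removed
    together. *)
Lemma ler_sum_count (C : numClosedFieldType) (T : eqType) (s t : seq T) (g : T -> C) (mu : nat) :
  (forall x, 0 <= g x) -> {subset s <= t} -> (forall x, (count_mem x s <= mu)%N) ->
  \sum_(x <- s) g x <= mu%:R * \sum_(x <- t) g x.
Proof.
move=> g0; elim: t s => [|a t IH] s st smu.
  have -> : s = [::] by case: s st {smu} => // x s /(_ x); rewrite inE eqxx => /(_ isT).
  by rewrite !big_nil mulr0.
rewrite big_cons mulrDr (bigID (pred1 a)) /= lerD //.
  rewrite (eq_bigr (fun=> g a)); last by move=> x /eqP ->.
  by rewrite big_const_seq iter_addr_0 -[leLHS]mulr_natl ler_wpM2r // ler_nat smu.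
rewrite -big_filter; apply: IH => x.
  by rewrite mem_filter => /andP[xa /st]; rewrite inE (negPf xa).
rewrite count_filter; apply: leq_trans (smu x); apply: sub_count => y /=.
by case/andP.
Qed.

(** The factor 2 accounts for the sign of a divisor. *)
Lemma size_int_divisors (hs : seq int) (n : int) : n != 0 -> uniq hs ->
  (count (fun h => (h %| n)%Z) hs <= 2 * size (divisors `|n|))%N.
Proof.
move=> n0 hsu; rewrite -size_filter -(size_map (fun h : int => (0 <= h, `|h|%N))).
rewrite -(_ : size [:: true; false] = 2)%N // -(size_allpairs pair).
apply: uniq_leq_size.
  rewrite map_inj_in_uniq ?filter_uniq // => x y _ _ [E1 E2].
  by move: E1 E2; case: (leP 0 x); case: (leP 0 y) => //; lia.
move=> y /mapP[h]; rewrite mem_filter => /andP[hn _] {y}->.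
apply/allpairsP; exists (0 <= h, `|h|%N); split => //=; first by case: (0 <= h).
by rewrite -dvdn_divisors // absz_gt0.
Qed.

Section DilateSum.
Variables (F : finFieldType) (C : numClosedFieldType) (Phi : F -> C).
Hypothesis Phi0 : forall t, 0 <= Phi t.

Lemma dilate_sum0 (hs : seq int) (k : nat) :
  dilate_sum hs Phi k 0 = (size hs)%:R ^+ k * Phi 0.
Proof.
elim: k => [|k IH] /=; first by rewrite mul1r.
under eq_bigr do rewrite mul0r IH.
by rewrite big_const_seq count_predT iter_addr_0 -[LHS]mulr_natl mulrA -exprS.
Qed.

(* Each of the k factors h is either 0, which leaves Phi 0, or multiplies the list s of
   integers by a nonzero h, which multiplies multiplicities by at most 2 T. *)
Lemma sum_dilate_sum_le (hs : seq int) (H k A mu T : nat) (s : seq int) (c : F) :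
  uniq hs -> {in hs, forall h, (`|h|%N <= H)%N} -> (0 < H)%N ->
  (forall b, b \in s -> b != 0 /\ (`|b|%N <= A)%N) ->
  (forall n, (count_mem n s <= mu)%N) ->
  (forall n, (0 < n <= A * H ^ k)%N -> (size (divisors n) <= T)%N) ->
  \sum_(b <- s) dilate_sum hs Phi k (c * b%:~R) <=
    (k * (size s * size hs ^ k.-1))%:R * Phi 0
    + (mu * (2 * T) ^ k)%:R * \sum_(n <- int_ball (A * H ^ k)) Phi (c * n%:~R).
Proof.
move=> hsu hsH H0; elim: k A mu s => [|k IH] A mu s sA smu hT.
  rewrite mul0n mul0r add0r expn0 !muln1 /=.
  by apply: ler_sum_count => // b /sA[_]; rewrite mem_int_ball.
pose hs' := [seq h <- hs | h != 0]; pose s' := [seq b * h | h <- hs', b <- s].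
have E : \sum_(b <- s) dilate_sum hs Phi k.+1 (c * b%:~R) =
    \sum_(b <- s) \sum_(h <- hs | h == 0) dilate_sum hs Phi k 0
    + \sum_(b <- s') dilate_sum hs Phi k (c * b%:~R).
  rewrite big_allpairs_dep [X in _ + X]exchange_big -big_split /=; apply: eq_bigr => b _.
  rewrite (bigID (pred1 0)) /= big_filter; congr (_ + _).
    by apply: eq_bigr => h /eqP ->; rewrite mulr0.
  by apply: eq_bigr => h _; rewrite intrM mulrA.
have s'A b : b \in s' -> b != 0 /\ (`|b|%N <= A * H)%N.
  case/allpairsP => -[h b'] /= [hh /sA[b0 bA] ->]; move: hh.
  rewrite mem_filter => /andP[h0 /hsH hH]; rewrite mulf_neq0 //; split => //.
  by rewrite abszM leq_mul.
have s's : (size s' <= size s * size hs)%N.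
  by rewrite size_allpairs mulnC leq_mul // size_filter count_size.
(* If [n = b * h], then [h] divides [n] and determines [b]; so at most [2 * T] values of [h] occur,
   each with at most [mu] copies of [b]. *)
have s'mu n : (count_mem n s' <= mu * (2 * T))%N.
  have [ns'|ns'] := boolP (n \in s'); last by rewrite (count_memPn ns').
  have [n0 nA] := s'A n ns'.
  rewrite count_flatten -map_comp sumnE big_map.
  apply: leq_trans (_ : \sum_(h <- hs') (if (h %| n)%Z then mu else 0) <= _)%N.
    rewrite [leqLHS]big_seq [leqRHS]big_seq; apply: leq_sum => h; rewrite mem_filter => /andP[h0 _] /=.
    rewrite count_map; case: ifP => hn.
      apply: leq_trans (smu (n %/ h)%Z); apply: sub_count => b /= /eqP <-.
      by rewrite mulzK.
    rewrite leqNgt -has_count; apply/hasPn => b _ /=.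
    by apply: contraFN hn => /eqP <-; rewrite dvdz_mull.
  rewrite -big_mkcond big_const_seq iter_addn_0 leq_mul //.
  apply: leq_trans (size_int_divisors n0 (filter_uniq _ hsu)) _.
  rewrite leq_mul // hT // absz_gt0 n0 (leq_trans nA) //.
  by rewrite leq_mul // -{1}(expn1 H) leq_pexp2l.
rewrite E; apply: le_trans (lerD (lexx _) (IH (A * H)%N (mu * (2 * T))%N s' s'A s'mu _)) _.
  by move=> n; rewrite -mulnA -expnS; exact: hT.
rewrite -mulnA -expnS -mulnA -expnS addrA lerD2r.
apply: le_trans (_ : ((size s * size hs ^ k) + k * (size s * size hs ^ k))%:R * Phi 0 <= _); last first.
  by rewrite mulSn.
rewrite natrD mulrDl; apply: lerD.
  rewrite big_const_seq count_predT iter_addr_0 -[leLHS]mulr_natl natrM -mulrA ler_wpM2l //.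
  rewrite big_const_seq iter_addr_0 dilate_sum0 natrX -[leRHS]mulr1 -[leLHS]mulr_natr.
  rewrite ler_wpM2l ?mulr_ge0 ?exprn_ge0 // (ler_nat _ _ 1).
  by rewrite (count_uniq_mem _ hsu); case: (_ \in _).
(* The predecessor in the exponent is harmless at [k = 0], where the factor [k] vanishes. *)
rewrite ler_wpM2r // ler_nat leq_mul2l; case: (k) => // j.
by rewrite (leq_trans (leq_mul s's (leqnn _))) ?orbT // -mulnA -expnS.
Qed.

End DilateSum.

Lemma sum_Fp (C : numClosedFieldType) (p : nat) (G : 'F_p -> C) : prime p ->
  \sum_(x : 'F_p) G x = \sum_(0 <= i < p) G i%:R.
Proof.
move=> pp; transitivity (\sum_(0 <= i < (Zp_trunc (pdiv p)).+2) G i%:R); last by rewrite (Fp_cast pp).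
rewrite big_mkord; apply: eq_bigr => x _.
by rewrite natr_Zp.
Qed.

(** The [2 * N + 1] consecutive integers are covered by blocks of length [p]; over each block
    [c * n] runs once through the field. *)
Lemma sum_int_ball_Fp (C : numClosedFieldType) (p N : nat) (Phi : 'F_p -> C) (c : 'F_p) :
  prime p -> (forall t, 0 <= Phi t) -> c != 0 ->
  \sum_(n <- int_ball N) Phi (c * n%:~R) <= (2 * N %/ p).+1%:R * \sum_t Phi t.
Proof.
move=> pp Phi0 c0; have p0 := prime_gt0 pp.
rewrite big_map.
pose G (i : nat) := Phi (c * (i%:Z - N%:Z)%:~R).
have blocks Q : \sum_(0 <= i < Q * p) G i = Q%:R * \sum_t Phi t.
  elim: Q => [|Q IH]; first by rewrite big_geq // mul0r.
  rewrite mulSn addnC (@big_cat_nat _ _ _ (Q * p)) ?leq_addr //= IH -natr1 mulrDl mul1r.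
  congr (_ + _); rewrite -{1}[(Q * p)%N]add0n big_addn addKn.
  have bij : bijective (fun x : 'F_p => c * (x + ((Q * p)%N%:Z - N%:Z)%:~R)).
    exists (fun y => c^-1 * y - ((Q * p)%N%:Z - N%:Z)%:~R) => x.
      by rewrite mulKf // addrK.
    by rewrite subrK mulVKf.
  rewrite [RHS](reindex _ (onW_bij _ bij)) /= sum_Fp //; apply: eq_bigr => i _.
  by rewrite /G !intrB PoszD intrD; congr (Phi (c * _)); ring.
rewrite -blocks -[iota _ _]/(index_iota 0 (2 * N).+1).
rewrite (@big_cat_nat _ _ _ (2 * N).+1 0 ((2 * N %/ p).+1 * p)) //= ?lerDl ?sumr_ge0 //.
by move=> i _; exact: Phi0.
exact: ltn_ceil.
Qed.

(** * Fejer weights and the Fejer kernel *)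

Section Fejer.
Variables (F : finFieldType) (C : numClosedFieldType) (e : F -> C).
Hypothesis eD : forall x y, e (x + y) = e x * e y.
Hypothesis e_norm : forall x, `|e x| = 1.
Hypothesis e_nontriv : exists x, e x != 1.

(** The transform of a product is a convolution up to a positive factor, so nonnegativity passes to
    powers. *)
Lemma fourier_exp_ge0 (phi : F -> C) (n : nat) :
  (forall t, 0 <= fourier e phi t) ->
  forall t, 0 <= fourier e (fun x => phi x ^+ n.+1) t.
Proof.
move=> phi0; elim: n => [|n IH] t.
  by rewrite /fourier; under eq_bigr do rewrite expr1; exact: phi0.
rewrite -(pmulr_rge0 _ (natr_card_gt0 F C)) [X in _ * X](_ : _ = fourier e (fun x => phi x * phi x ^+ n.+1) t).
  rewrite fourierM_conv //; apply: sumr_ge0 => u _; exact: mulr_ge0.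
by apply: eq_bigr => x _; rewrite exprS.
Qed.

Variable I : {set F}.

(** The autocorrelation of the indicator of [I]: it counts the ways to write [x] as a difference of
    two elements of [I]. *)
Definition fejer (x : F) : C := #|[set u in I | u + x \in I]|%:R.

Lemma fejerE x : fejer x = \sum_(u in I) (u + x \in I)%:R.
Proof.
rewrite /fejer -natr_sum -sum1_card; congr _%:R.
rewrite (eq_bigl (fun u => (u \in I) && (u + x \in I))) => [|u]; last by rewrite inE.
rewrite big_mkcondr.
by apply: eq_bigr => u _; case: (_ \in I).
Qed.

(** Substituting [v = u + x] factors the double sum; in particular the transform is nonnegative. *)
Lemma fourier_fejer t : fourier e fejer t = `|\sum_(u in I) e (t * u)| ^+ 2.
Proof.
rewrite normCK rmorph_sum mulr_sumr /fourier.
under eq_bigr do rewrite fejerE mulr_suml.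
rewrite exchange_big /=; apply: eq_bigr => u _.
rewrite (reindex_inj (addrI (- u))) /= mulr_suml [RHS]big_mkcond.
apply: eq_bigr => v _; rewrite addNKr -addcharN //.
by case: (v \in I); rewrite ?mul0r // mul1r -eD; congr e; ring.
Qed.

Lemma fejer0 : fejer 0 = #|I|%:R.
Proof. by congr _%:R; apply: eq_card => u; rewrite inE addr0 andbb. Qed.

Lemma fejer_le x : fejer x <= #|I|%:R.
Proof.
by rewrite ler_nat subset_leq_card //; apply/fintype.subsetP => u; rewrite inE => /andP[].
Qed.

Lemma sum_fejer : \sum_x fejer x = #|I|%:R ^+ 2.
Proof.
rewrite (_ : \sum_x fejer x = fourier e fejer 0).
  rewrite fourier_fejer; under eq_bigr do rewrite mul0r (addchar0 eD e_norm).
  by rewrite sumr_const ger0_norm ?ler0n.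
by apply: eq_bigr => x _; rewrite mul0r (addchar0 eD e_norm) mulr1.
Qed.

Lemma fejer_supp x : fejer x != 0 -> exists u v, [/\ u \in I, v \in I & x = v - u].
Proof.
rewrite pnatr_eq0 cards_eq0 => /set0Pn[u]; rewrite inE => /andP[uI uxI].
by exists u, (u + x); rewrite uI uxI addrAC subrr add0r.
Qed.

End Fejer.

Section FpChar.
Variables (p : nat) (C : numClosedFieldType) (z : C).
Hypotheses (p_pr : prime p) (zp : z ^+ p = 1).

Definition Fp_char (x : 'F_p) : C := z ^+ x.

Lemma Fp_char_nat n : Fp_char n%:R = z ^+ n.
Proof. by rewrite /Fp_char val_Fp_nat // expr_mod. Qed.

Lemma Fp_charD x y : Fp_char (x + y) = Fp_char x * Fp_char y.
Proof. by rewrite -[x]natr_Zp -[y]natr_Zp -natrD !Fp_char_nat exprD. Qed.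

Lemma norm_root_unity : `|z| = 1.
Proof.
apply/eqP; rewrite -(pexpr_eq1 (n := p)) ?prime_gt0 //.
by rewrite -normrX zp normr1.
Qed.

Lemma Fp_char_norm x : `|Fp_char x| = 1.
Proof. by rewrite normrX norm_root_unity expr1n. Qed.

(** Consecutive powers of [z] are all at distance [|1 - z|], because [z] has modulus 1. *)
Lemma dist_expr_le n : `|1 - z ^+ n| <= n%:R * `|1 - z|.
Proof.
elim: n => [|n IH]; first by rewrite expr0 subrr normr0 mul0r.
rewrite (_ : 1 - z ^+ n.+1 = (1 - z ^+ n) + z ^+ n * (1 - z)); last by rewrite exprSr; ring.
apply: le_trans (ler_normD _ _) _.
by rewrite normrM normrX norm_root_unity expr1n mul1r -natr1 mulrDl mul1r lerD2r.
Qed.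

(* As a y < L M for all a < L, no term of the kernel leaves the disc of radius 1/2 about 1. *)
Lemma kernel_lower_bound (L M : nat) (y : 'F_p) :
  `|1 - z| * p%:R <= 16 -> (32 * M * L <= p)%N -> (y < M)%N ->
  L%:R <= 2 * `|\sum_(0 <= a < L) Fp_char (a%:R * y)|.
Proof.
move=> z1 MLp yM; have p0 : (0 : C) < p%:R by rewrite ltr0n prime_gt0.
(* The distance is at most [16 * a * y / p], and [32 * a * y <= 32 * M * L <= p]. *)
have hz : forall a, (a < L)%N -> `|1 - Fp_char (a%:R * y)| <= 2^-1.
  move=> a aL; rewrite -[y]natr_Zp -natrM Fp_char_nat.
  apply: le_trans (dist_expr_le _) _.
  rewrite -(ler_pM2r p0) -mulrA; apply: le_trans (ler_wpM2l (ler0n _ _) z1) _.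
  rewrite -(ler_pM2l (ltr0Sn C 1)) mulVKf ?pnatr_eq0 // -!natrM ler_nat.
  by apply: leq_trans MLp; nia.
set K := \sum_(0 <= a < L) _.
have LK : L%:R - `|K| <= L%:R * 2^-1.
  apply: le_trans (_ : `|L%:R - K| <= _).
    by rewrite -{1}(ger0_norm (ler0n C L)) lerB_dist.
  rewrite (_ : L%:R = \sum_(0 <= a < L) (1 : C)); last by rewrite sumr_const_nat subn0.
  rewrite -sumrB mulr_suml; apply: le_trans (ler_norm_sum _ _ _) _.
  rewrite big_seq [leRHS]big_seq; apply: ler_sum => a; rewrite mem_index_iota mul1r => /andP[_].
  exact: hz.
have : 2 * (L%:R - `|K|) <= 2 * (L%:R * 2^-1) by rewrite ler_wpM2l.
rewrite mulrCA mulfV ?pnatr_eq0 // mulr1 mulrBr lerBlDr.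
by rewrite [2 * L%:R]mulr_natl mulr2n lerD2l.
Qed.

End FpChar.

(** * The box count for small boxes *)

Lemma prime_ndvd_fact (p n : nat) : prime p -> (n < p)%N -> ~~ (p %| n`!)%N.
Proof.
move=> pp; elim: n => [|n IH] np; first by rewrite dvdn1 neq_ltn prime_gt1 ?orbT.
by rewrite factS Euclid_dvdM // negb_or IH ?(ltnW np) // andbT gtnNdvd.
Qed.

Lemma leq_expn2r (m n e : nat) : (m <= n)%N -> (m ^ e <= n ^ e)%N.
Proof. by case: e => // e mn; rewrite leq_exp2r. Qed.

Lemma card_Fp_lt (p n : nat) : prime p -> (n <= p)%N ->
  #|[set x : 'F_p | (x < n)%N]| = n.
Proof.
move=> pp np; rewrite -sum1dep_card -(big_ord_widen _ (fun=> 1%N)); last by rewrite (Fp_cast pp).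
by rewrite sum1_card card_ord.
Qed.

Section Concentration.
Variables (p : nat) (C : numClosedFieldType) (z : C).
Hypotheses (p_pr : prime p) (zp : z ^+ p = 1) (z_neq1 : z != 1).
Hypothesis z_near1 : `|1 - z| * p%:R <= 16.
Variables (M L k : nat) (f : {poly 'F_p}) (r s : 'F_p).
Hypotheses (M_gt0 : (0 < M)%N) (L_gt0 : (0 < L)%N) (MLp : (32 * M * L <= p)%N).

Local Notation e := (Fp_char z).
Let eD := Fp_charD p_pr zp.
Let e_norm := Fp_char_norm p_pr zp.

Let e_nontriv : exists x : 'F_p, e x != 1.
Proof. by exists 1%:R; rewrite Fp_char_nat // expr1. Qed.

Let M_p : (2 * M <= p)%N. Proof. by nia. Qed.
Let MC : 0 < M%:R :> C. Proof. by rewrite ltr0n. Qed.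

(** The length is [2 * M] so that every [x < M] is a difference of elements of the box in at least
    [M] ways; division by [M] then gives a weight at least 1 there. *)
Definition box : {set 'F_p} := [set x : 'F_p | (x < 2 * M)%N].
Definition weight (x : 'F_p) : C := fejer C box x / M%:R.

Lemma weight_ge0 x : 0 <= weight x.
Proof. by rewrite divr_ge0 ?ler0n. Qed.

Lemma weight_conj x : (weight x)^* = weight x.
Proof. exact/geC0_conj/weight_ge0. Qed.

Lemma weight0 : weight 0 = 2.
Proof.
by rewrite /weight fejer0 card_Fp_lt // natrM mulfK // lt0r_neq0.
Qed.

Lemma weight_le2 x : weight x <= 2.
Proof. by rewrite -weight0 ler_pM2r ?invr_gt0 // fejer0 fejer_le. Qed.

Lemma sum_weight : \sum_x weight x = 4 * M%:R.
Proof.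
rewrite -mulr_suml (sum_fejer eD e_norm) card_Fp_lt // natrM.
rewrite (_ : (2%:R * M%:R) ^+ 2 = 4%:R * M%:R * M%:R :> C); last by ring.
by rewrite mulfK // lt0r_neq0.
Qed.

Lemma weight_ge1 (x : 'F_p) : (x < M)%N -> 1 <= weight x.
Proof.
move=> xM; rewrite ler_pdivlMr // mul1r ler_nat.
rewrite -[X in (X <= _)%N](@card_Fp_lt p M) //; last by nia.
apply: subset_leq_card; apply/fintype.subsetP => u; rewrite !inE => uM.
rewrite (leq_trans uM) ?leq_pmull //=.
by apply: leq_ltn_trans (leq_mod _ _) _; lia.
Qed.

Lemma fourier_weight t : fourier e weight t = fourier e (fejer C box) t / M%:R.
Proof. by rewrite /fourier mulr_suml; apply: eq_bigr => x _; rewrite mulrAC. Qed.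

Lemma fourier_weight_ge0 t : 0 <= fourier e weight t.
Proof. by rewrite fourier_weight fourier_fejer // divr_ge0 ?exprn_ge0 ?ler0n. Qed.

(** Each shifted argument is a difference of two integers in [[0, 2 * M)], so two of them differ by
    less than [4 * M]. *)
Lemma weight_supp x y : weight (x - r) != 0 -> weight (y - r) != 0 ->
  x - y \in [seq h%:~R | h <- int_ball (4 * M)].
Proof.
have supp w : weight (w - r) != 0 -> exists i j : nat,
    [/\ (i < 2 * M)%N, (j < 2 * M)%N & w - r = j%:R - i%:R].
  rewrite mulf_eq0 negb_or => /andP[/fejer_supp[u [v []]]].
  rewrite !inE => uI vI E _; exists u, v; split => //.
  by rewrite !natr_Zp.
move=> /supp[i [j [iM jM E]]] /supp[i' [j' [i'M j'M E']]].
rewrite (_ : x - y = (j%:Z - i%:Z - (j'%:Z - i'%:Z))%:~R).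
  by apply: map_f; rewrite mem_int_ball; lia.
by rewrite !intrB -!pmulrn -E -E'; ring.
Qed.

Definition poly_sum (t : 'F_p) : C := \sum_x weight (x - r) * e (t * f.[x]).

Definition box_set : {set 'F_p} :=
  [set x : 'F_p | ((x - r)%R < M)%N && ((f.[x] - s)%R < M)%N].

Lemma poly_sum0 : `|poly_sum 0| = 4 * M%:R.
Proof.
rewrite /poly_sum -sum_weight (reindex_inj (addIr r)) /=.
under eq_bigr do rewrite mul0r (addchar0 eD e_norm) mulr1 addrK.
by rewrite ger0_norm // sumr_ge0 // => x _; exact: weight_ge0.
Qed.

Let kernel (y : 'F_p) := \sum_(0 <= a < L) e (a%:R * y).

(** On [box_set] the weight is at least 1 and the kernel at least [L / 2] in modulus; all other
    terms are nonnegative. *)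
Lemma card_box_set_le_kernel :
  #|box_set|%:R * L%:R ^+ 2 <=
    4 * \sum_x weight (x - r) * `|kernel (f.[x] - s)| ^+ 2.
Proof.
rewrite -sum1_card natr_sum mulr_suml big_mkcond mulr_sumr; apply: ler_sum => x _.
rewrite inE mul1r; case: ifP => [/andP[xr fs]|_]; last first.
  by apply: mulr_ge0 => //; apply: mulr_ge0; rewrite ?exprn_ge0 ?weight_ge0.
rewrite mulrCA -[leLHS]mul1r; apply: ler_pM; rewrite ?ler01 ?exprn_ge0 ?ler0n //.
- exact: (weight_ge1 xr).
- rewrite (_ : 4 = 2 ^+ 2 :> C); last by rewrite -natrX.
  rewrite -exprMn lerXn2r ?nnegrE ?mulr_ge0 //.
  exact: (kernel_lower_bound p_pr zp z_near1 MLp).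
Qed.

(** Expanding the square produces the frequencies [a - b]. For fixed [a] they are distinct and lie
    in [int_ball L], so each of the [L] values of [a] costs at most one full sum. *)
Lemma kernel_sum_le :
  \sum_x weight (x - r) * `|kernel (f.[x] - s)| ^+ 2 <=
    L%:R * \sum_(n <- int_ball L) `|poly_sum n%:~R|.
Proof.
have E : \sum_x weight (x - r) * `|kernel (f.[x] - s)| ^+ 2 =
    \sum_(0 <= a < L) \sum_(0 <= b < L)
      e (- ((a%:R - b%:R) * s)) * poly_sum (a%:Z - b%:Z)%:~R.
  under eq_bigr => x _.
    rewrite normCK rmorph_sum mulr_suml mulr_sumr.
    under eq_bigr => a _ do rewrite !mulr_sumr.
    over.
  rewrite exchange_big /=; apply: eq_bigr => a _.
  rewrite exchange_big /=; apply: eq_bigr => b _.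
  rewrite mulr_sumr; apply: eq_bigr => x _.
  rewrite -addcharN // -eD [RHS]mulrCA -eD; congr (_ * e _).
  by rewrite intrB -!pmulrn; ring.
have nonneg : 0 <= \sum_x weight (x - r) * `|kernel (f.[x] - s)| ^+ 2.
  by apply: sumr_ge0 => x _; rewrite mulr_ge0 ?exprn_ge0 ?weight_ge0.
rewrite -(ger0_norm nonneg) E.
apply: le_trans (_ : \sum_(0 <= a < L) \sum_(n <- int_ball L) `|poly_sum n%:~R| <= _); last first.
  by rewrite sumr_const_nat subn0 mulr_natl.
apply: le_trans (ler_norm_sum _ _ _) _; rewrite big_seq [leRHS]big_seq.
apply: ler_sum => a; rewrite mem_index_iota => /= aL.
apply: le_trans (ler_norm_sum _ _ _) _.
rewrite (eq_bigr (fun b : nat => `|poly_sum (a%:Z - b%:Z)%:~R|)); last first.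
  by move=> b _; rewrite normrM e_norm mul1r.
rewrite -(big_map (fun b : nat => a%:Z - b%:Z) xpredT (fun n => `|poly_sum n%:~R|)).
have := @ler_sum_count C _ [seq a%:Z - b%:Z | b <- index_iota 0 L] (int_ball L)
  (fun n => `|poly_sum n%:~R|) 1.
rewrite mul1r; apply=> // [n /mapP[b]|n].
  by rewrite mem_index_iota mem_int_ball => bL ->; lia.
rewrite count_uniq_mem; first by case: (_ \in _).
by rewrite map_inj_uniq ?iota_uniq // => b b'; lia.
Qed.

Definition freqs : seq int := [seq n <- int_ball L | n != 0].

Lemma size_freqs : size freqs = (2 * L)%N.
Proof.
have := perm_size (perm_to_rem (_ : 0 \in int_ball L)); rewrite mem_int_ball => /(_ isT).
by rewrite rem_filter ?int_ball_uniq // size_int_ball => -[<-].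
Qed.

(** One factor [L] cancels, and the frequency 0 contributes [4 * (4 * M)]. *)
Lemma card_box_set_le :
  #|box_set|%:R * L%:R <= 16 * M%:R + 4 * \sum_(n <- freqs) `|poly_sum n%:~R|.
Proof.
have := le_trans card_box_set_le_kernel (ler_wpM2l (ler0n _ 4) kernel_sum_le).
rewrite expr2 mulrA mulrCA mulrC ler_pM2l ?ltr0n //.
rewrite (bigID (pred1 0)) /= -[X in _ + X]big_filter mulrDr => /le_trans; apply.
rewrite lerD2r -big_filter (_ : [seq i <- _ | _] = [:: 0]); last first.
  rewrite (filter_pred1_uniq (int_ball_uniq L)) // mem_int_ball //.
by rewrite big_seq1 poly_sum0 (_ : 4 * (4 * M%:R) = 16 * M%:R :> C) //; ring.
Qed.

Hypotheses (fk : (size f <= k.+2)%N) (k_gt0 : (0 < k)%N).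

Let Phi : 'F_p -> C := fourier e (fun x => weight x ^+ (2 ^ k)).

(** Differencing is applied to [t *: f]. The translate of [weight] by [r] is majorized by [weight]
    itself, since translation only changes phases. *)
Lemma poly_sum_weyl (t : 'F_p) :
  `|poly_sum t| ^+ (2 ^ k) <=
    (8 * M).+1%:R ^+ (2 ^ k - k.+1) *
    dilate_sum (int_ball (4 * M)) Phi k ((k.+1)`!%:R * f`_k.+1 * t).
Proof.
have := @weyl_differencing _ _ e eD e_norm e_nontriv (int_ball (4 * M)) k (t *: f)
  (fun x => weight (x - r)) weight _ weight_supp weight_conj _.
rewrite size_int_ball mulnA coefZ.
under eq_bigr do rewrite hornerZ.
rewrite [t * f`__]mulrC mulrA; apply; first exact: leq_trans (size_scale_leq _ _) fk.
move=> u; rewrite (fourier_shift eD) normrM e_norm mul1r ger0_norm //.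
exact: fourier_weight_ge0.
Qed.

Lemma fourier_weight_exp_ge0 t : 0 <= Phi t.
Proof.
rewrite /Phi; have := expn_gt0 2 k; case: (2 ^ k)%N => // n _.
exact: (fourier_exp_ge0 eD e_norm e_nontriv _ fourier_weight_ge0).
Qed.

(** All but one of the factors [weight] are bounded by 2; the last one has sum [4 * M]. *)
Lemma fourier_weight_exp0_le : Phi 0 <= (2 ^ 2 ^ k * (2 * M))%:R.
Proof.
rewrite /Phi /fourier; have := expn_gt0 2 k; case: (2 ^ k)%N => // n _.
apply: le_trans (_ : \sum_x 2 ^+ n * weight x <= _).
  apply: ler_sum => x _; rewrite mul0r (addchar0 eD e_norm) mulr1 exprSr.
  rewrite ler_wpM2r ?weight_ge0 // lerXn2r ?nnegrE ?weight_ge0 //.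
  exact: weight_le2.
rewrite -mulr_sumr sum_weight -natrX -!natrM ler_nat expnSr.
by rewrite -mulnA leq_mul2l mulnA leqnn orbT.
Qed.

Lemma sum_fourier_weight_exp : \sum_t Phi t = (p * 2 ^ 2 ^ k)%:R.
Proof.
by rewrite fourier_sum // weight0 card_Fp // natrM natrX.
Qed.

Variable T : nat.
Hypotheses (fk_neq0 : f`_k.+1 != 0) (kp : (k.+1 < p)%N).
Hypothesis hT : forall n, (0 < n <= L * (4 * M) ^ k)%N -> (size (divisors n) <= T)%N.

Lemma sum_poly_sum_power_le :
  \sum_(n <- freqs) `|poly_sum n%:~R| ^+ (2 ^ k) <=
  ((8 * M).+1 ^ (2 ^ k - k.+1) *
    (k * (2 * L * (8 * M).+1 ^ k.-1) * (2 ^ 2 ^ k * (2 * M))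
     + (2 * T) ^ k * ((2 * (L * (4 * M) ^ k) %/ p).+1 * (p * 2 ^ 2 ^ k))))%:R.
Proof.
rewrite natrM natrX.
apply: le_trans (_ : (8 * M).+1%:R ^+ (2 ^ k - k.+1) *
  \sum_(n <- freqs) dilate_sum (int_ball (4 * M)) Phi k ((k.+1)`!%:R * f`_k.+1 * n%:~R) <= _).
  by rewrite mulr_sumr; apply: ler_sum => n _; exact: poly_sum_weyl.
rewrite ler_wpM2l ?exprn_ge0 //.
set c := _ * f`_k.+1.
(* The factorial is invertible modulo [p] because [k.+1 < p]. *)
have c0 : c != 0.
  by rewrite mulf_neq0 // -(dvdn_pcharf (pchar_Fp p_pr)) // prime_ndvd_fact.
apply: le_trans (@sum_dilate_sum_le _ _ Phi fourier_weight_exp_ge0 (int_ball (4 * M)) (4 * M) k L 1 T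
  freqs c _ _ _ _ _ _) _.
- exact: int_ball_uniq.
- by move=> h; rewrite mem_int_ball.
- by rewrite muln_gt0 M_gt0.
- by move=> b; rewrite mem_filter mem_int_ball => /andP[].
- move=> n; rewrite count_uniq_mem ?filter_uniq ?int_ball_uniq //; by case: (_ \in _).
- exact: hT.
rewrite size_freqs size_int_ball mulnA mul1n natrD [X in _ <= X + _]natrM [X in _ <= _ + X]natrM.
apply: lerD; first by rewrite !mulnA ler_wpM2l -?mulnA ?fourier_weight_exp0_le.
rewrite ler_wpM2l // natrM -sum_fourier_weight_exp; apply: sum_int_ball_Fp => //; exact: fourier_weight_exp_ge0.
Qed.

Lemma card_box_set_power_le :
  ((#|box_set| * L - 16 * M) ^ 2 ^ k <=
   4 ^ 2 ^ k * ((2 * L) ^ (2 ^ k - 1) * ((8 * M).+1 ^ (2 ^ k - k.+1) *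
    (k * (2 * L * (8 * M).+1 ^ k.-1) * (2 ^ 2 ^ k * (2 * M))
     + (2 * T) ^ k * ((2 * (L * (4 * M) ^ k) %/ p).+1 * (p * 2 ^ 2 ^ k))))))%N.
Proof.
(* In the first case the truncated subtraction on the left is 0. *)
have [le|/ltnW ge] := leqP (#|box_set| * L) (16 * M).
  by rewrite (eqP le) exp0n ?expn_gt0.
have h : (#|box_set| * L - 16 * M)%:R <= 4 * \sum_(n <- freqs) `|poly_sum n%:~R|.
  by rewrite natrB // !natrM lerBlDl; exact: card_box_set_le.
rewrite -(ler_nat C) natrX.
apply: le_trans (_ : (4 * \sum_(n <- freqs) `|poly_sum n%:~R|) ^+ (2 ^ k) <= _).
  by rewrite lerXn2r ?nnegrE // mulr_ge0 // sumr_ge0.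
rewrite exprMn !natrM !natrX ler_wpM2l ?exprn_ge0 //.
apply: le_trans (power_mean _ _ _) _ => //.
rewrite size_freqs natrM ler_wpM2l ?exprn_ge0 ?mulr_ge0 //.
by apply: le_trans sum_poly_sum_power_le _; rewrite natrM natrX.
Qed.

(** As [M * L] is comparable to [p], the terms with a vanishing shift and those without are of the
    same order in [M] and [L], up to the divisor factor [T ^ k]. *)
Lemma card_box_set_power_bound : (p <= 64 * M * L)%N ->
  ((#|box_set| * L - 16 * M) ^ 2 ^ k <=
   (4 ^ 2 ^ k * 2 ^ (2 ^ k - 1) * 2 ^ 2 ^ k * 9 ^ (2 ^ k - 2) * 64 * (k + 2 * 2 ^ k))
   * (T ^ k * L ^ 2 ^ k * M ^ (2 ^ k - 1)))%N.
Proof.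
move=> pML; apply: leq_trans card_box_set_power_le _.
have T0 : (0 < T)%N.
  by apply: leq_trans (hT (n := 1) _); rewrite ?muln_gt0 ?expn_gt0 ?muln_gt0 ?L_gt0 ?M_gt0.
have [j kE] : exists j, k = j.+1 by exists k.-1; rewrite prednK.
have Dk : (k.+1 <= 2 ^ k)%N by exact: ltn_expl.
set D := (2 ^ k)%N in Dk *.
have M9 : ((8 * M).+1 <= 9 * M)%N by lia.
(* One factor [4 * M] is spent with [2 * L] against [p], as [8 * M * L <= p]; base [9 * M] is chosen
   to match the bound for [(8 * M).+1]. *)
have Q : ((2 * (L * (4 * M) ^ k) %/ p).+1 <= 2 * (9 * M) ^ k.-1)%N.
  have M1 : (0 < (9 * M) ^ k.-1)%N by rewrite expn_gt0 muln_gt0 M_gt0.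
  have : (2 * (L * (4 * M) ^ k) %/ p <= (9 * M) ^ k.-1)%N.
    have M49 : ((4 * M) ^ k.-1 <= (9 * M) ^ k.-1)%N.
      by rewrite leq_expn2r ?leq_mul.
    apply: leq_trans M49; rewrite kE expnS /=.
    rewrite -[X in (_ <= X)%N](mulKn _ (prime_gt0 p_pr)) leq_div2r //.
    by rewrite !mulnA leq_mul2r; apply/orP; right; nia.
  by move: M1; lia.
have B : (k * (2 * L * (8 * M).+1 ^ k.-1) * (2 ^ D * (2 * M))
     + (2 * T) ^ k * ((2 * (L * (4 * M) ^ k) %/ p).+1 * (p * 2 ^ D))
     <= (9 * M) ^ k.-1 * (2 ^ D * p * ((k + 2 * D) * T ^ k)))%N.
  have T1 : (0 < T ^ k)%N by rewrite expn_gt0 T0.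
  have := leq_expn2r k.-1 M9; rewrite (expnMn 2 T) -/D.
  move: Q; move: (_ %/ p).+1 => q; move: (T ^ k)%N T1 => t t1 Qle.
  move: Qle; move: ((9 * M) ^ _)%N ((8 * M).+1 ^ _)%N (D) (2 ^ D)%N => G E a b qG EG.
  rewrite (_ : G * _ = G * (b * p * (k * t)) + G * (b * p * (2 * a * t)))%N; last by nia.
  apply: leq_add.
    apply: leq_trans (_ : k * (2 * L * G) * (b * (2 * M)) <= _)%N.
      by rewrite leq_mul2r leq_mul2l leq_mul2l EG !orbT.
    rewrite (_ : (k * (2 * L * G) * (b * (2 * M)) = (k * G * b) * (4 * L * M))%N); last by nia.
    rewrite (_ : (G * (b * p * (k * t)) = (k * G * b) * (p * t))%N); last by nia.
    by rewrite leq_mul2l; apply/orP; right; nia.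
  apply: leq_trans (_ : a * t * (2 * G * (p * b)) <= _)%N; last by nia.
  by rewrite leq_mul2l leq_mul2r qG !orbT.
clearbody D.
apply: leq_trans (_ : 4 ^ D * ((2 * L) ^ (D - 1) * ((9 * M) ^ (D - k.+1) *
  ((9 * M) ^ k.-1 * (2 ^ D * (64 * M * L) * ((k + 2 * D) * T ^ k))))) <= _)%N.
  rewrite !leq_mul2l; apply/orP; right; apply/orP; right.
  apply: leq_mul; first exact: leq_expn2r.
  apply: leq_trans B _.
  by rewrite leq_mul2l leq_mul2r leq_mul2l pML !orbT.
(* The exponents add up to [D - 2]; replacing [p] by [64 * M * L] restores one [M] and one [L]. *)
have E9 : ((9 * M) ^ (D - k.+1) * (9 * M) ^ k.-1 = 9 ^ (D - 2) * M ^ (D - 2))%N.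
  rewrite -expnD -expnMn; congr expn.
  by move: k_gt0 Dk; clear; lia.
have EL : (L ^ D = L ^ (D - 1) * L)%N by rewrite -expnSr; congr expn; move: Dk; clear; lia.
have EM : (M ^ (D - 1) = M ^ (D - 2) * M)%N.
  by rewrite -expnSr; congr expn; move: k_gt0 Dk; clear; lia.
rewrite mulnA.
rewrite EL EM (expnMn 2 L).
move: E9; move: (4 ^ D)%N (2 ^ (D - 1))%N (L ^ (D - 1))%N (9 ^ _)%N (M ^ _)%N (2 ^ D)%N
  (T ^ k)%N (k + _)%N ((9 * M) ^ (D - k.+1))%N ((9 * M) ^ k.-1)%N.
move=> a b c d e' g t h u v E9.
rewrite leq_eqVlt; apply/orP; left; apply/eqP.
transitivity (a * b * c * (u * v) * g * 64 * M * L * h * t)%N; first by nia.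
rewrite E9; nia.
Qed.

End Concentration.

(** * A complex root of unity close to 1 *)

Section RootOfUnity.
Variable K : realType.
Implicit Types t : K.

Lemma sin_le_id t : 0 <= t -> `|sin t| <= t.
Proof.
rewrite le_eqVlt => /predU1P[<-|t0]; first by rewrite sin0 normr0.
have [|c _] := @MVT K sin cos 0 t t0.
  by apply: continuous_subspaceT => x; exact: continuous_sin.
rewrite sin0 !subr0 => ->; rewrite normrM (gtr0_norm t0).
by rewrite ler_piMl ?cos_max // ltW.
Qed.

Lemma cos_dist_le t : 0 <= t -> `|1 - cos t| <= t.
Proof.
rewrite le_eqVlt => /predU1P[<-|t0]; first by rewrite cos0 subrr normr0.
have [|c _] := @MVT K cos (fun x => - sin x) 0 t t0.
  by apply: continuous_subspaceT => x; exact: continuous_cos.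
rewrite cos0 subr0 distrC => ->; rewrite normrM normrN (gtr0_norm t0).
by rewrite ler_piMl ?sin_max // ltW.
Qed.

Definition cis t : K[i] := Complex (cos t) (sin t).

Lemma cis_exp t n : cis t ^+ n = cis (t *+ n).
Proof.
elim: n => [|n IH]; first by rewrite expr0 mulr0n /cis cos0 sin0.
rewrite exprS IH mulrS /cis cosD sinD; apply/eqP.
by rewrite eq_complex /= eqxx addrC eqxx.
Qed.

(** The root is [cis t] with [t = 2 pi / p]. Both coordinates of [1 - z] are at most [t] in absolute
    value, so [|1 - z| <= 2 * t], and [pi <= 4] yields 16. It differs from 1 since cosine is
    injective on [[0, pi]]. *)
Lemma root_unity_near1 (p : nat) : (1 < p)%N ->
  exists z : K[i], [/\ z ^+ p = 1, z != 1 & `|1 - z| * p%:R <= 16].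
Proof.
move=> p1; have p0 : (0 : K) < p%:R by rewrite ltr0n ltnW.
pose t : K := pi *+ 2 / p%:R.
have pi0 : 0 < pi :> K by exact: pi_gt0.
have pi4 : pi <= 4 :> K by have /andP[_] := (@pihalf_02_cos_pihalf K).1; lra.
have t0 : 0 < t by rewrite divr_gt0 // mulrn_wgt0.
have tpi : t <= pi.
  rewrite ler_pdivrMr // -[leLHS]mulr_natr ler_pM2l //.
  by rewrite ler_nat.
have t8 : t * p%:R <= 8 by rewrite divfK ?gt_eqF //; lra.
exists (cis t); split.
- by rewrite cis_exp -mulr_natr divfK ?gt_eqF // /cis cos2pi sin2pi.
- have : cos t < cos 0.
    by rewrite ltr_cos // in_itv /= ?lexx ?(ltW t0) ?(ltW pi0).
  rewrite cos0 => ct; rewrite eq_complex /= negb_and; apply/orP; left.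
  by rewrite lt_eqF.
have sq_le x y : `|x| <= y -> x ^+ 2 <= y ^+ 2 :> K.
  by move=> xy; rewrite -real_normK ?num_real // lerXn2r ?nnegrE // (le_trans _ xy).
have tn : `|1 - cis t| <= (2 * t)%:C%C.
  have t20 : 0 <= 2 * t by lra.
  rewrite normc_def lecR /= -[leRHS](ger0_norm t20).
  rewrite -sqrtr_sqr ler_wsqrtr // sub0r sqrrN exprMn.
  have := sq_le _ _ (cos_dist_le (ltW t0)); have := sq_le _ _ (sin_le_id (ltW t0)).
  by have := sqr_ge0 t; lra.
apply: le_trans (ler_wpM2r (ler0n _ _) tn) _.
rewrite -(rmorph_nat (real_complex K) p) -rmorphM -(rmorph_nat (real_complex K) 16) lecR.
by rewrite -mulrA; lra.
Qed.

End RootOfUnity.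

(** * The divisor bound as a power of p with exponent tending to 0 *)

(** The range contains every [n <= L * (4 * M) ^ k] with [m = k.+1] and [L], [M] at most [p], so the
    maximum depends on [p] and the degree alone. *)
Definition max_divisors (m p : nat) : nat :=
  (\max_(n < ((4 * p) ^ m).+1) size (divisors n))%N.

Lemma size_divisors_le_max (m p n : nat) :
  (n <= (4 * p) ^ m)%N -> (size (divisors n) <= max_divisors m p)%N.
Proof.
by rewrite -ltnS => np; exact: (leq_bigmax (Ordinal np)).
Qed.

Lemma max_divisors_gt0 (m p : nat) : (0 < p)%N -> (0 < max_divisors m p)%N.
Proof.
move=> p0; apply: leq_trans (size_divisors_le_max (n := 1) _) => //.
by rewrite expn_gt0 muln_gt0 p0.
Qed.

Lemma max_divisors_expn (j : nat) : (0 < j)%N ->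
  exists2 c, (0 < c)%N & forall m p, (0 < p)%N -> (max_divisors m p ^ j <= c * (4 * p) ^ m)%N.
Proof.
move=> j0; have [c hc] := size_divisors_expn j.
exists c.+1 => // m p p0; rewrite /max_divisors.
have [|i ->] := @bigop.eq_bigmax _ (fun n : 'I_((4 * p) ^ m).+1 => size (divisors n)).
  by rewrite card_ord.
(* The range includes 0, for which [divisors] has a single element by convention. *)
case: (posnP i) => [->|i0]; first by rewrite exp1n muln_gt0 expn_gt0 muln_gt0 p0.
apply: leq_trans (hc _ i0) _; rewrite leq_mul //.
by rewrite -ltnS.
Qed.

(** Chosen so that [n] to this exponent is exactly the [k]-th power of [max_divisors m n]. *)
Definition divisor_exponent (K : realType) (m k n : nat) : K :=
  ln ((max_divisors m n)%:R ^+ k) / ln n%:R.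

Lemma divisor_exponentE (K : realType) (m k n : nat) : (1 < n)%N ->
  n%:R `^ divisor_exponent K m k n = (max_divisors m n)%:R ^+ k.
Proof.
move=> n1; have n0 : (0 : K) < n%:R by rewrite ltr0n ltnW.
have ln0 : 0 < ln n%:R :> K by rewrite ln_gt0 // ltr1n.
rewrite /powR gt_eqF // divfK ?gt_eqF // lnK //.
by rewrite posrE exprn_gt0 // ltr0n max_divisors_gt0 // ltnW.
Qed.

Local Open Scope classical_set_scope.
Local Open Scope ring_scope.

(** The divisor bound with power [j.+1] makes the exponent at most [k * m.+1 / j.+1] for large [n],
    and [j] is arbitrary. *)
Lemma divisor_exponent_cvg0 (K : realType) (m k : nat) :
  divisor_exponent K m k n @[n --> \oo] --> (0 : K).
Proof.
apply/cvgrPdist_le => /= d d0.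
have [j jd] : exists j : nat, (k * m.+1)%:R / d < j.+1%:R :> K.
  exists (Num.bound ((k * m.+1)%:R / d)).
  apply: lt_trans (archi_boundP _) _; last by rewrite ltr_nat.
  by rewrite divr_ge0 ?ler0n ?(ltW d0).
have [c c0 hc] := max_divisors_expn (ltn0Sn j).
near=> n.
have n1 : (1 < n)%N by near: n; exact: nbhs_infty_gt.
have n0 : (0 : K) < n%:R by rewrite ltr0n ltnW.
have ln0 : 0 < ln n%:R :> K by rewrite ln_gt0 // ltr1n.
have T0 : (0 : K) < (max_divisors m n)%:R by rewrite ltr0n max_divisors_gt0 // ltnW.
(* For large [n] the constant is absorbed by one further factor [n], whence [m.+1] in place of
   [m]. *)
have cn : ln (c * 4 ^ m)%:R <= ln n%:R :> K.
  rewrite ler_ln ?posrE ?ltr0n ?muln_gt0 ?c0 ?expn_gt0 ?(ltnW n1) // ler_nat.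
  by near: n; exact: nbhs_infty_ge.
have lnT0 : 0 <= ln (max_divisors m n)%:R :> K.
  by rewrite ln_ge0 // ler1n -(ltr0n K).
have lnT : ln (max_divisors m n)%:R *+ j.+1 <= m.+1%:R * ln n%:R :> K.
  rewrite -lnXn // -[m.+1%:R]natr1 mulrDl mul1r.
  apply: le_trans (_ : ln ((c * 4 ^ m)%:R * n%:R ^+ m) <= _).
    rewrite ler_ln ?posrE ?mulr_gt0 ?(exprn_gt0 _ T0) ?(exprn_gt0 _ n0) ?ltr0n ?muln_gt0 ?c0 ?expn_gt0 //.
    by rewrite -!natrX -natrM ler_nat -mulnA -expnMn hc // ltnW.
  have c40 : (0 : K) < (c * 4 ^ m)%:R by rewrite ltr0n muln_gt0 c0 expn_gt0.
  rewrite lnM ?posrE ?(exprn_gt0 _ n0) // lnXn // addrC [m%:R * _]mulr_natl.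
  by rewrite lerD2l.
rewrite sub0r normrN ger0_norm /divisor_exponent; last first.
  by apply: divr_ge0; [rewrite lnXn // mulrn_wge0 | exact: ltW].
rewrite ler_pdivrMr // lnXn //.
rewrite -(ler_pM2r (ltr0Sn K j)).
have -> : ln (max_divisors m n)%:R *+ k * j.+1%:R = k%:R * (ln (max_divisors m n)%:R *+ j.+1) :> K.
  by rewrite mulr_natr mulr_natl -!mulrnA mulnC.
apply: le_trans (ler_wpM2l (ler0n _ _) lnT) _.
rewrite mulrA -natrM mulrAC ler_wpM2r ?ltW //.
by move: jd; rewrite ltr_pdivrMr // mulrC.
Unshelve. all: by end_near.
Qed.

(** * From integer points to residues, and the final estimate *)

Lemma dvdn_absz_Fp (p : nat) (n : int) : prime p -> n%:~R == 0 :> 'F_p -> (p %| `|n|)%N.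
Proof.
move=> pp; case: n => n; rewrite ?NegzE ?mulrNz ?oppr_eq0 ?abszN -pmulrn => n0;
  by rewrite (dvdn_pcharf (pchar_Fp pp)).
Qed.

(** Reducing [x] modulo [p] is injective on the counted pairs: [f] determines the residue of [y],
    and an interval of [M <= p] integers has at most one member in each class. *)
Lemma J_le_card_box_set (p : nat) (f : {poly 'F_p}) (R S : int) (M : nat) :
  prime p -> (M <= p)%N ->
  (J f M R S <= #|box_set M f (R + 1)%:~R (S + 1)%:~R|)%N.
Proof.
move=> pp Mp; rewrite /J; set A := fset_set _.
have inA xy : xy \in A -> box_points f M R S xy.
  by rewrite in_fset_set ?inE //; exact: finite_box_points.
have val_lt (T w : int) : T + 1 <= w <= T + M%:Z ->
    ((w%:~R - (T + 1)%:~R : 'F_p)%R < M)%N.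
  move=> wT; rewrite -intrB (_ : w - (T + 1) = `|(w - (T + 1))%R|%N%:Z); last by lia.
  by rewrite -pmulrn val_Fp_nat // (leq_ltn_trans (leq_mod _ _)) //; lia.
have injA : {in enum_fset A &, injective (fun xy : int * int => xy.1%:~R : 'F_p)}.
  move=> [x y] [x' y'] /inA[/= hx hy fx] /inA[/= hx' hy' fx'] E.
  have inj (T w w' : int) : T + 1 <= w <= T + M%:Z -> T + 1 <= w' <= T + M%:Z ->
      w%:~R = w'%:~R :> 'F_p -> w = w'.
    move=> hw hw' /eqP; rewrite -subr_eq0 -intrB.
    move=> /(dvdn_absz_Fp pp) pw; suff : `|(w - w')%R|%N = 0%N by lia.
    by apply/eqP; apply: contraLR pw; rewrite -lt0n => w0; rewrite gtnNdvd //; lia.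
  by rewrite (inj R x x') // (inj S y y') // -fx -fx' E.
rewrite -(size_map (fun xy : int * int => xy.1%:~R : 'F_p)) cardE.
apply: uniq_leq_size; first by rewrite map_inj_in_uniq // fset_uniq.
move=> _ /mapP[[x y] /inA[/= hx hy fx] ->]; rewrite mem_enum inE val_lt //= fx.
exact: val_lt.
Qed.

Lemma card_box_set_le_M (p : nat) (f : {poly 'F_p}) (r s : 'F_p) (M : nat) :
  prime p -> (M <= p)%N -> (#|box_set M f r s| <= M)%N.
Proof.
move=> pp Mp; rewrite -[X in (_ <= X)%N](card_Fp_lt pp Mp).
rewrite -[X in (X <= _)%N](card_imset _ (addIr (- r))); apply: subset_leq_card.
by apply/fintype.subsetP => _ /finset.imsetP[x + ->]; rewrite !inE => /andP[].
Qed.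

Lemma box_set_power_le (K : realType) (k : nat) : (0 < k)%N ->
  exists2 c, (0 < c)%N &
  forall (p : nat) (f : {poly 'F_p}) (r s : 'F_p) (M L : nat),
    prime p -> size f = k.+2 -> (k.+1 < p)%N -> (0 < M)%N -> (0 < L)%N ->
    (32 * M * L <= p)%N -> (p <= 64 * M * L)%N ->
    ((#|box_set M f r s| * L - 16 * M) ^ 2 ^ k <=
      c * (max_divisors k.+1 p ^ k * L ^ 2 ^ k * M ^ (2 ^ k - 1)))%N.
Proof.
move=> k0.
exists (4 ^ 2 ^ k * 2 ^ (2 ^ k - 1) * 2 ^ 2 ^ k * 9 ^ (2 ^ k - 2) * 64 * (k + 2 * 2 ^ k))%N.
  by rewrite !muln_gt0 !expn_gt0 addn_gt0 k0.
move=> p f r s M L pp sf kp M0 L0 MLp pML.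
have [z [zp z1 zn]] := root_unity_near1 K (prime_gt1 pp).
apply: (card_box_set_power_bound pp zp z1 zn) => //.
- by rewrite sf.
- by rewrite -[k.+1]/(k.+2.-1) -sf -lead_coefE lead_coef_eq0 -size_poly_eq0 sf.
- move=> n /andP[_ nN]; apply: size_divisors_le_max; apply: leq_trans nN _.
  by rewrite expnS leq_mul // ?leq_expn2r //; nia.
Qed.

Theorem theorem5 (K : realType) (m : nat) (hm : (2 <= m)%N) :
  exists2 C : K, 0 < C &
  exists2 eps : nat -> K, eps n @[n --> \oo] --> (0 : K) &
    forall (p : nat) (f : {poly 'F_p}) (R S : int) (M : nat),
      prime p -> size f = m.+1 -> (1 <= M < p)%N ->
      (J f M R S)%:R <=
        C * (M%:R ^+ 2 / p%:R
             + M%:R `^ (1 - 1 / 2 ^+ (m - 1)) * p%:R `^ (eps p)).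
Proof.
case: m hm => // -[//|k'] _; set k := k'.+1; have k0 : (0 < k)%N by [].
rewrite subn1 /=.
have [c c0 hc] := @box_set_power_le K k k0.
(* The 16 comes from the frequency 0 and the 64 from [p <= 64 * M * L]; [A] is kept abstract to stop
   it from being computed. *)
have [A AE] : {A : K | A = 16 * 64} by exists (16 * 64).
have A32 : 32 <= A by rewrite AE -natrM ler_nat.
have A0 : 0 < A by apply: lt_le_trans A32; rewrite ltr0n.
exists (A + c%:R + k.+1%:R); first by rewrite !addr_gt0 ?ltr0n.
exists (divisor_exponent K k.+1 k); first exact: divisor_exponent_cvg0.
move=> p f R S M pp sf /andP[M0 Mp].
have p0 : (0 : K) < p%:R by rewrite ltr0n prime_gt0.
have M1 : (1 : K) <= M%:R by rewrite ler1n.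
rewrite divisor_exponentE ?prime_gt1 //.
set D : K := 2 ^+ k; set T := max_divisors k.+1 p.
have D1 : 1 <= D by rewrite /D exprn_ege1 // ler1n.
have T0 : (0 < T)%N by rewrite max_divisors_gt0 ?prime_gt0.
have P1 : (1 : K) <= T%:R ^+ k by rewrite exprn_ege1 // ler1n.
set a : K := 1 - 1 / D.
have a0 : 0 <= a by rewrite subr_ge0 div1r invf_le1 // (lt_le_trans ltr01).
have Q1 : 1 <= M%:R `^ a by rewrite -[X in X <= _](powRr0 M%:R) ler_powR.
set Q := M%:R `^ a in Q1 *; set P := T%:R ^+ k in P1 *.
set X := #|box_set M f (R + 1)%:~R (S + 1)%:~R|.
have JX : (J f M R S <= X)%N by apply: J_le_card_box_set => //; exact: ltnW.
apply: le_trans (_ : X%:R <= _); first by rewrite ler_nat.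
have XM : X%:R <= M%:R :> K by rewrite ler_nat card_box_set_le_M // ltnW.
have QP : 1 <= Q * P by rewrite -[X in X <= _]mulr1 ler_pM.
have main0 : 0 <= M%:R ^+ 2 / p%:R :> K by rewrite divr_ge0 ?exprn_ge0.
have QP0 : 0 <= Q * P by exact: le_trans ler01 QP.
have cK0 : (0 : K) <= c%:R by [].
have kK0 : (0 : K) <= k.+1%:R by [].
set Z := M%:R ^+ 2 / p%:R in main0 *.
(* For bounded [p] the trivial bound [M] is at most a constant. *)
have [pk|kp] := leqP p k.+1.
  apply: (le_trans XM); apply: le_trans (_ : k.+1%:R * (Q * P) <= _).
    rewrite -[leLHS]mulr1 ler_pM // ler_nat; exact: leq_trans (ltnW Mp) pk.
  by apply: ler_pM => //; lra.
(* For [p < 32 * M] the trivial bound is already at most [32 * M ^ 2 / p]. *)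
have [Mlarge|Msmall] := ltnP p (32 * M).
  apply: (le_trans XM); apply: le_trans (_ : A * Z <= _).
    have pM : p%:R <= 32 * M%:R :> K by rewrite -natrM ler_nat ltnW.
    apply: le_trans (_ : 32 * Z <= _); last by rewrite ler_wpM2r.
    by rewrite mulrA ler_pdivlMr // expr2 mulrCA ler_wpM2l.
  by apply: ler_pM; [exact: ltW | exact: main0 | rewrite -addrA lerDl addr_ge0 | rewrite lerDl].
pose L := (p %/ (32 * M))%N.
have L0 : (0 < L)%N by rewrite divn_gt0 // muln_gt0.
have MLp : (32 * M * L <= p)%N by rewrite mulnC leq_trunc_div.
have pML : (p <= 64 * M * L)%N.
  have : (p < L.+1 * (32 * M))%N by rewrite ltn_ceil // muln_gt0.
  by move: (L) L0 => l l0 lt; clear -l0 lt; nia.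
have := hc p f (R + 1)%:~R (S + 1)%:~R M L pp sf kp M0 L0 MLp pML.
rewrite -/X -/T; set y := (X * L - 16 * M)%N => hy.
have L0K : (0 : K) < L%:R by rewrite ltr0n.
(* The root of order [2 ^ k] is taken by comparing powers; [c] and [P] are at least 1, hence at most
   their own powers. *)
have yle : y%:R <= c%:R * L%:R * (Q * P) :> K.
  have QD : Q ^+ (2 ^ k) = M%:R ^+ (2 ^ k - 1).
    rewrite -powR_mulrn ?powR_ge0 // -powRrM -powR_mulrn ?ler0n //; congr powR.
    rewrite natrB ?expn_gt0 // natrX -/D /a mulrBl !mul1r mulVf // gt_eqF //.
    exact: lt_le_trans ltr01 D1.
  have n0 : (0 < 2 ^ k)%N by rewrite expn_gt0.
  have c1 : (1 : K) <= c%:R by rewrite ler1n.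
  have r0 : 0 <= c%:R * L%:R * (Q * P) by apply: mulr_ge0 => //; exact: mulr_ge0.
  rewrite -(ler_pXn2r n0) ?nnegrE ?ler0n //.
  apply: le_trans (_ : (c * (T ^ k * L ^ 2 ^ k * M ^ (2 ^ k - 1)))%:R <= _).
    by rewrite -natrX ler_nat.
  rewrite !exprMn QD natrM !natrM !natrX -/P.
  have cn : c%:R <= c%:R ^+ (2 ^ k) :> K by exact: ler_eXnr.
  have Pn : P <= P ^+ (2 ^ k) by exact: ler_eXnr.
  rewrite [leLHS](_ : _ = c%:R * L%:R ^+ (2 ^ k) * (M%:R ^+ (2 ^ k - 1) * P)); last by ring.
  apply: ler_pM.
  - by apply: mulr_ge0 => //; exact: exprn_ge0.
  - by apply: mulr_ge0; [exact: exprn_ge0 | exact: le_trans ler01 P1].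
  - by apply: ler_wpM2r => //; exact: exprn_ge0.
  - by apply: ler_wpM2l => //; exact: exprn_ge0.
have Xy : X%:R * L%:R <= 16 * M%:R + y%:R :> K.
  by rewrite -!natrM -natrD ler_nat -leq_subLR.
rewrite -(ler_pM2r L0K); apply: (le_trans Xy).
(* After division by [L], the contribution of the frequency 0 is of order [M ^ 2 / p]. *)
have ML : 16 * M%:R <= A * Z * L%:R.
  have pK : p%:R <= 64 * M%:R * L%:R :> K by rewrite -!natrM ler_nat.
  rewrite mulrA mulrAC ler_pdivlMr // (_ : A * _ * _ = 16 * M%:R * (64 * M%:R * L%:R)); last by rewrite AE; ring.
  by rewrite ler_wpM2l ?mulr_ge0.
apply: le_trans (lerD ML yle) _; rewrite -subr_ge0.
rewrite [X in 0 <= X](_ : _ = L%:R * (A * (Q * P) + c%:R * Z + k.+1%:R * Z + k.+1%:R * (Q * P))).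
  have A00 := ltW A0.
  by apply: mulr_ge0 => //; repeat (apply: addr_ge0); apply: mulr_ge0.
ring.
Qed.
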